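(* Let $k$ be a field, $\mathfrak S$ a $k$-linear Grothendieck category with an injective cogenerator $\mathcal I$, $H$ a cosemisimple Hopf algebra over $k$ and $A$ a right $H$-comodule algebra. Suppose that $\underline{Hom}(A,\mathcal I)\otimes H\in\mathcal F({}_A\mathfrak S^H)$. Then $\mathcal F({}_A\mathfrak S^H)={}_A\mathfrak S^H$, i.e., every object $\mathcal M\in{}_A\mathfrak S^H$ satisfies ${}_A\mathfrak K^H(\mathcal M)=0$.
   Context: Write $\otimes=\otimes_k$. For $\mathcal M\in\mathfrak S$ and a $k$-vector space $V$, $\mathcal M\otimes V\in\mathfrak S$ is defined by letting $\mathcal M\otimes-:k\text{-Mod}\to\mathfrak S$ be the left adjoint of $\mathfrak S(\mathcal M,-)$; we identify $V\otimes\mathcal M$ with $\mathcal M\otimes V$, and $T$ denotes such swap isomorphisms. The functor $-\otimes V:\mathfrak S\to\mathfrak S$ has a right adjoint $\underline{Hom}(V,-)$. ${}_A\mathfrak S$ is the category of left $A$-module objects in $\mathfrak S$ (objects with an associative unital action $A\otimes\mathcal M\to\mathcal M$). For $\mathcal M\in\mathfrak S$, $\underline{Hom}(A,\mathcal M)$ is a left $A$-module object via the multiplication of $A$ (right multiplication of $A$ on itself); this makes $\underline{Hom}(A,-):\mathfrak S\to{}_A\mathfrak S$ right adjoint to the forgetful functor. $H$ is cosemisimple if there is a left integral $\phi:H\to k$ (i.e. a $k$-linear map with $\sum h_1\phi(h_2)=\phi(h)1_H$ for all $h$) such that $\phi(1_H)=1$; then $\phi$ is also a right integral, $\sum\phi(h_1)h_2=\phi(h)1_H$.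 Fix such $\phi$. ${}_A\mathfrak S^H$ is the category of left-right relative $(A,H)$-Hopf module objects in $\mathfrak S$: triples $(\mathcal M,\mu_{\mathcal M}^A,\Delta_{\mathcal M}^H)$ where $\mu_{\mathcal M}^A:A\otimes\mathcal M\to\mathcal M$ is a left $A$-module structure on $\mathcal M\in\mathfrak S$, $\Delta_{\mathcal M}^H:\mathcal M\to\mathcal M\otimes H$ is a right $H$-comodule structure, and $\Delta^H_{\mathcal M}\circ\mu^A_{\mathcal M}=(\mu^A_{\mathcal M}\otimes\mu_H)\circ(A\otimes T_{H,\mathcal M}\otimes H)\circ(\Delta_A^H\otimes\Delta^H_{\mathcal M})$; morphisms are morphisms in $\mathfrak S$ compatible with the $A$-action and $H$-coaction. For $\mathcal M\in{}_A\mathfrak S$, $\mathcal M\otimes H\in{}_A\mathfrak S^H$ with coaction $\mathcal M\otimes\Delta_H$ and $A$-action $(\mu_{\mathcal M}^A\otimes\mu_H)\circ(A\otimes T_{H,\mathcal M}\otimes H)\circ(\Delta_A^H\otimes\mathcal M\otimes H)$. For $\mathcal M\in{}_A\mathfrak S^H$, $\mathfrak K^H(\mathcal M)$ is the kernel of $(\mathcal M\otimes\phi)\circ\Delta_{\mathcal M}^H:\mathcal M\to\mathcal M$, and ${}_A\mathfrak K^H(\mathcal M)$ is the sum of all subobjects $\mathcal M'\subseteq\mathcal M$ in ${}_A\mathfrak S^H$ such that $\mathcal M'\subseteq\mathfrak K^H(\mathcal M)$. $\mathcal F({}_A\mathfrak S^H)$ is the full subcategory of ${}_A\mathfrak S^H$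 of objects $\mathcal M$ with ${}_A\mathfrak K^H(\mathcal M)=0$. A cogenerator of an abelian category is an object $E$ such that for any epimorphism $X\twoheadrightarrow Y$ that is not an isomorphism there is a morphism $X\to E$ not factoring through $Y$. *)

(* Defs.v *)
From HB Require Import structures.
From mathcomp Require Import all_boot all_algebra.
From mathcomp Require Import boolp.

Set Implicit Arguments.
Unset Strict Implicit.
Unset Printing Implicit Defensive.

Import GRing.Theory.
Local Open Scope ring_scope.
Local Open Scope quotient_scope.

Declare Scope tensor_scope.
Delimit Scope tensor_scope with tensor.
Local Open Scope tensor_scope.

Definition mklin (k : fieldType) (U V : lmodType k) (f : U -> V)
    (fL : linear f) : {linear U -> V} :=
  HB.pack f (GRing.isLinear.Build k U V *:%R f fL).

Definition mkbil (k : fieldType) (U V W : lmodType k) (f : U -> V -> W)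
    (fL : bilinear_for *:%R *:%R f) : {bilinear U -> V -> W} :=
  HB.pack f (bilinear_isBilinear.Build k U V W *:%R *:%R f fL).

Section Tensor.
Variables (k : fieldType) (V W : lmodType k).
Implicit Types s t : seq (V * W).

Definition bilsum (U : lmodType k) (b : V -> W -> U) s : U :=
  \sum_(p <- s) b p.1 p.2.

(* A sequence of pairs stands for the formal sum of the v ⊗ w; two formal sums
   are identified when no bilinear map separates them. *)
Definition tens_eq : rel (seq (V * W)) := fun s t =>
  `[< forall (U : lmodType k) (b : {bilinear V -> W -> U}),
        bilsum b s = bilsum b t >].

Lemma tens_eq_equiv : equiv_class_of tens_eq.
Proof.
split=> [s|s t|t s u].
- exact/asboolP.
- by apply/asboolP/asboolP=> st U b; rewrite st.
- by move=> /asboolP st /asboolP tu; apply/asboolP=> U b; rewrite st tu.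
Qed.
Canonical tens_eq_canonical := EquivRelPack tens_eq_equiv.

Definition tensor := {eq_quot tens_eq}.
HB.instance Definition _ := Choice.on tensor.
HB.instance Definition _ := EqQuotient.on tensor.

Definition tens_class s : tensor := \pi_tensor s.
Definition tens_repr (t : tensor) : seq (V * W) := repr t.

Lemma tens_classP s t :
  (forall (U : lmodType k) (b : {bilinear V -> W -> U}),
     bilsum b s = bilsum b t) <-> tens_class s = tens_class t.
Proof.
split=> [st|/eqmodP/asboolP //].
by apply/eqmodP/asboolP.
Qed.

Lemma tens_reprK (t : tensor) : tens_class (tens_repr t) = t.
Proof. exact: reprK. Qed.

Lemma bilsum_repr (U : lmodType k) (b : {bilinear V -> W -> U}) s :
  bilsum b (tens_repr (tens_class s)) = bilsum b s.
Proof. by move: U b; apply/tens_classP; rewrite tens_reprK. Qed.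

Definition seq_scale (a : k) s := [seq (a *: p.1, p.2) | p <- s].

Lemma bilsum_cat (U : lmodType k) (b : V -> W -> U) s t :
  bilsum b (s ++ t) = bilsum b s + bilsum b t.
Proof. by rewrite /bilsum big_cat. Qed.

Lemma bilsum_scale (U : lmodType k) (b : {bilinear V -> W -> U}) a s :
  bilsum b (seq_scale a s) = a *: bilsum b s.
Proof.
rewrite /bilsum big_map scaler_sumr; apply: eq_bigr => p _ /=.
by rewrite linearZl_LR.
Qed.

Definition tens_add (x y : tensor) := tens_class (tens_repr x ++ tens_repr y).
Definition tens_scale a (x : tensor) := tens_class (seq_scale a (tens_repr x)).
Definition tens_zero := tens_class [::].
Definition tens_opp := tens_scale (-1).

Lemma tens_sep (x y : tensor) :
  (forall (U : lmodType k) (b : {bilinear V -> W -> U}),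
     bilsum b (tens_repr x) = bilsum b (tens_repr y)) -> x = y.
Proof. by rewrite -{2}(tens_reprK x) -{2}(tens_reprK y) tens_classP. Qed.

Lemma bilsum_add (U : lmodType k) (b : {bilinear V -> W -> U}) x y :
  bilsum b (tens_repr (tens_add x y)) =
  bilsum b (tens_repr x) + bilsum b (tens_repr y).
Proof. by rewrite bilsum_repr bilsum_cat. Qed.

Lemma bilsum_tscale (U : lmodType k) (b : {bilinear V -> W -> U}) a x :
  bilsum b (tens_repr (tens_scale a x)) = a *: bilsum b (tens_repr x).
Proof. by rewrite bilsum_repr bilsum_scale. Qed.

Lemma bilsum_zero (U : lmodType k) (b : {bilinear V -> W -> U}) :
  bilsum b (tens_repr tens_zero) = 0.
Proof. by rewrite bilsum_repr /bilsum big_nil. Qed.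

Let bilE := (bilsum_add, bilsum_tscale, bilsum_zero).

Lemma tens_addA : associative tens_add.
Proof. by move=> x y z; apply: tens_sep => U b; rewrite !bilE addrA. Qed.
Lemma tens_addC : commutative tens_add.
Proof. by move=> x y; apply: tens_sep => U b; rewrite !bilE addrC. Qed.
Lemma tens_add0 : left_id tens_zero tens_add.
Proof. by move=> x; apply: tens_sep => U b; rewrite !bilE add0r. Qed.
Lemma tens_addN : left_inverse tens_zero tens_opp tens_add.
Proof. by move=> x; apply: tens_sep => U b; rewrite !bilE scaleN1r addNr. Qed.

HB.instance Definition _ :=
  GRing.isZmodule.Build tensor tens_addA tens_addC tens_add0 tens_addN.

Lemma tens_scaleA a b x : tens_scale a (tens_scale b x) = tens_scale (a * b) x.
Proof. by apply: tens_sep => U f; rewrite !bilE scalerA. Qed.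
Lemma tens_scale1 : left_id 1 tens_scale.
Proof. by move=> x; apply: tens_sep => U f; rewrite !bilE scale1r. Qed.
Lemma tens_scaleDr : right_distributive tens_scale +%R.
Proof. by move=> a x y; apply: tens_sep => U f; rewrite !bilE scalerDr. Qed.
Lemma tens_scaleDl x : {morph tens_scale^~ x : a b / a + b}.
Proof. by move=> a b; apply: tens_sep => U f; rewrite !bilE scalerDl. Qed.

HB.instance Definition _ :=
  GRing.Zmodule_isLmodule.Build k tensor
    tens_scaleA tens_scale1 tens_scaleDr tens_scaleDl.

Definition pure (v : V) (w : W) : tensor := tens_class [:: (v, w)].

Lemma pure_bilinear : bilinear_for *:%R *:%R pure.
Proof.
by split=> [w a v v'|v a w w']; apply: tens_sep => U b;
  rewrite !(bilE, bilsum_repr) /bilsum !big_seq1 /= ?linearPl ?linearPr.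
Qed.
HB.instance Definition _ :=
  bilinear_isBilinear.Build k V W tensor *:%R *:%R pure pure_bilinear.

Section Lift.
Variables (U : lmodType k) (b : {bilinear V -> W -> U}).

Definition tens_lift (x : tensor) : U := bilsum b (tens_repr x).

Lemma tens_lift_linear : linear tens_lift.
Proof. by move=> a x y; rewrite /tens_lift !bilE. Qed.
HB.instance Definition _ :=
  GRing.isLinear.Build k tensor U *:%R tens_lift tens_lift_linear.

Lemma tens_liftE v w : tens_lift (pure v w) = b v w.
Proof. by rewrite /tens_lift bilsum_repr /bilsum big_seq1. Qed.
End Lift.

Lemma tens_class_sum s : tens_class s = \sum_(p <- s) pure p.1 p.2.
Proof.
elim: s => [|p s IH]; first by rewrite big_nil.
rewrite big_cons -IH; apply: tens_sep => U b.
by rewrite !(bilE, bilsum_repr) /bilsum big_cons big_seq1.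
Qed.

Lemma tens_ext (U : lmodType k) (f g : {linear tensor -> U}) :
  (forall v w, f (pure v w) = g (pure v w)) -> f =1 g.
Proof.
move=> fg x; rewrite -(tens_reprK x) tens_class_sum !linear_sum.
by apply: eq_bigr => p _.
Qed.

Lemma tens_ext_fun (U : lmodType k) (f g : tensor -> U) :
  linear f -> linear g -> (forall v w, f (pure v w) = g (pure v w)) -> f =1 g.
Proof. by move=> fL gL; apply: (tens_ext (f := mklin fL) (g := mklin gL)). Qed.

End Tensor.

Notation "V ⊗ W" := (tensor V W) (at level 40, left associativity) : tensor_scope.
Notation "v ⊗ₑ w" := (pure v w) (at level 40, left associativity) : tensor_scope.

Section TensorMaps.
Variable k : fieldType.
Implicit Types U V W : lmodType k.

Section Map.
Variables (V V' W W' : lmodType k).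
Variables (f : {linear V -> V'}) (g : {linear W -> W'}).
Lemma tens_map_bilinear :
  bilinear_for *:%R *:%R (fun v w => f v ⊗ₑ g w).
Proof.
by split=> [w a v v'|v a w w'] /=; rewrite linearP ?linearPl ?linearPr.
Qed.
Definition tens_map : {linear V ⊗ W -> V' ⊗ W'} :=
  tens_lift (mkbil tens_map_bilinear).
Lemma tens_mapE v w : tens_map (v ⊗ₑ w) = f v ⊗ₑ g w.
Proof. exact: tens_liftE. Qed.
End Map.

Section Assoc.
Variables (U V W : lmodType k).
Lemma assoc_in_bilinear (w : W) :
  bilinear_for *:%R *:%R (fun (u : U) (v : V) => u ⊗ₑ (v ⊗ₑ w)).
Proof.
by split=> [v a u u'|u a v v'] /=; rewrite ?linearPl ?linearPr.
Qed.
Lemma assoc_bilinear :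
  bilinear_for *:%R *:%R
    (fun (x : U ⊗ V) (w : W) => tens_lift (mkbil (assoc_in_bilinear w)) x).
Proof.
split=> [w a x y|x a w w'] /=; first by rewrite linearP.
pose F w := tens_lift (mkbil (assoc_in_bilinear w)).
pose lhs : {linear _ -> _} := F (a *: w + w').
have rL : linear (fun x => a *: F w x + F w' x).
  by move=> c s t; rewrite /F !linearP /= !scalerA [c * a]mulrC addrACA.
apply: (tens_ext (f := lhs) (g := mklin rL)) => u v /=.
by rewrite /F !tens_liftE /= !linearPr.
Qed.
Definition tens_assoc : {linear U ⊗ V ⊗ W -> U ⊗ (V ⊗ W)} :=
  tens_lift (mkbil assoc_bilinear).
Lemma tens_assocE u v w : tens_assoc (u ⊗ₑ v ⊗ₑ w) = u ⊗ₑ (v ⊗ₑ w).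
Proof. by apply: etrans (tens_liftE (mkbil assoc_bilinear) _ _) _; rewrite /= tens_liftE. Qed.
End Assoc.

Section Unit.
Variable V : lmodType k.
Lemma runit_bilinear :
  bilinear_for *:%R *:%R (fun (v : V) (c : k^o) => c *: v).
Proof.
split=> [c a v v'|v a c c'] /=; first by rewrite scalerDr !scalerA mulrC.
by rewrite scalerDl scalerA.
Qed.
(* V ⊗ k -> V *)
Definition tens_runit : {linear V ⊗ k^o -> V} := tens_lift (mkbil runit_bilinear).
Lemma tens_runitE v c : tens_runit (v ⊗ₑ c) = c *: v.
Proof. exact: tens_liftE. Qed.

Lemma lunit_bilinear :
  bilinear_for *:%R *:%R (fun (c : k^o) (v : V) => c *: v).
Proof.
split=> [v a c c'|c a v v'] /=; first by rewrite scalerDl scalerA.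
by rewrite scalerDr !scalerA mulrC.
Qed.
(* k ⊗ V -> V *)
Definition tens_lunit : {linear k^o ⊗ V -> V} := tens_lift (mkbil lunit_bilinear).
Lemma tens_lunitE c v : tens_lunit (c ⊗ₑ v) = c *: v.
Proof. exact: tens_liftE. Qed.
End Unit.

End TensorMaps.
Arguments tens_assoc {k U V W}.
Arguments tens_runit {k V}.
Arguments tens_lunit {k V}.

(* [algType k] excludes the zero algebra, which is allowed here. *)
Record algebra (k : fieldType) := Algebra {
  alg_sort :> lmodType k;
  amul : {bilinear alg_sort -> alg_sort -> alg_sort};
  aone : alg_sort;
  amulA : associative amul;
  amul1l : left_id aone amul;
  amul1r : right_id aone amul }.
Arguments amul {k a} : rename.
Arguments aone {k} a : rename.

Definition mulmap (k : fieldType) (A : algebra k) : {linear A ⊗ A -> A} :=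
  tens_lift (@amul _ A).

Arguments mulmap {k A}.

Section TensorAlgebra.
Variables (k : fieldType) (A B : algebra k).

Lemma lmul_linear (C : algebra k) (c : C) : linear (amul c).
Proof. by move=> a x y; rewrite linearPr. Qed.
Definition lmul (C : algebra k) (c : C) : {linear C -> C} :=
  mklin (lmul_linear c).

Lemma tens_amul_bilinear (y : A ⊗ B) :
  bilinear_for *:%R *:%R (fun (a : A) (b : B) => tens_map (lmul a) (lmul b) y).
Proof.
split=> [b c a a'|a c b b'] /=.
- have rL : linear (fun y => c *: tens_map (lmul a) (lmul b) y +
                             tens_map (lmul a') (lmul b) y).
    by move=> d s t; rewrite !linearP /= !scalerA [d * c]mulrC addrACA.
  apply: (tens_ext (g := mklin rL)) => u v /=.
  by rewrite !tens_mapE /= !linearPl.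
- have rL : linear (fun y => c *: tens_map (lmul a) (lmul b) y +
                             tens_map (lmul a) (lmul b') y).
    by move=> d s t; rewrite !linearP /= !scalerA [d * c]mulrC addrACA.
  apply: (tens_ext (g := mklin rL)) => u v /=.
  by rewrite !tens_mapE /= linearPl linearPr.
Qed.

(* The product of the algebra A ⊗ B: (a ⊗ b)(a' ⊗ b') = aa' ⊗ bb'. *)
Definition tens_amul (x y : A ⊗ B) : A ⊗ B :=
  tens_lift (mkbil (tens_amul_bilinear y)) x.

Lemma tens_amulE a b a' b' :
  tens_amul (a ⊗ₑ b) (a' ⊗ₑ b') = amul a a' ⊗ₑ amul b b'.
Proof. by rewrite /tens_amul tens_liftE /= tens_mapE. Qed.

Lemma tens_amul_linear_l y : linear (fun x => tens_amul x y).
Proof. by move=> a s t; rewrite /tens_amul linearP. Qed.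
Lemma tens_amul_linear_r x : linear (tens_amul x).
Proof.
move=> c y z.
have rL : linear (fun x => c *: tens_amul x y + tens_amul x z).
  by move=> d s t; rewrite !tens_amul_linear_l !scalerDr !scalerA [d * c]mulrC addrACA.
apply: (tens_ext (f := mklin (tens_amul_linear_l _)) (g := mklin rL)) => a b /=.
by rewrite /tens_amul !tens_liftE /= linearP.
Qed.

End TensorAlgebra.

Record hopf_algebra (k : fieldType) := HopfAlgebra {
  hopf_alg :> algebra k;
  comul : {linear hopf_alg -> hopf_alg ⊗ hopf_alg};
  counit : {linear hopf_alg -> k^o};
  antipode : {linear hopf_alg -> hopf_alg};
  comulA : forall h,
    tens_assoc (tens_map comul idfun (comul h)) = tens_map idfun comul (comul h);
  comul_counitr : forall h, tens_runit (tens_map idfun counit (comul h)) = h;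
  comul_counitl : forall h, tens_lunit (tens_map counit idfun (comul h)) = h;
  comulM : forall g h, comul (amul g h) = tens_amul (comul g) (comul h);
  comul1 : comul (aone hopf_alg) = aone hopf_alg ⊗ₑ aone hopf_alg;
  counitM : forall g h, counit (amul g h) = counit g * counit h;
  counit1 : counit (aone hopf_alg) = 1;
  antipodel : forall h,
    mulmap (tens_map antipode idfun (comul h)) = counit h *: aone hopf_alg;
  antipoder : forall h,
    mulmap (tens_map idfun antipode (comul h)) = counit h *: aone hopf_alg }.
Arguments comul {k} h : rename.
Arguments counit {k} h : rename.

Record comodule_algebra (k : fieldType) (H : hopf_algebra k) := ComoduleAlgebra {
  ca_alg :> algebra k;
  acoact : {linear ca_alg -> ca_alg ⊗ H};
  acoactA : forall a,
    tens_assoc (tens_map acoact idfun (acoact a)) =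
    tens_map idfun (comul H) (acoact a);
  acoact_counit : forall a, tens_runit (tens_map idfun (counit H) (acoact a)) = a;
  acoactM : forall a b, acoact (amul a b) = tens_amul (acoact a) (acoact b);
  acoact1 : acoact (aone ca_alg) = aone ca_alg ⊗ₑ aone H }.
Arguments acoact {k H} A : rename.

Definition left_integral (k : fieldType) (H : hopf_algebra k)
    (phi : {linear H -> k^o}) : Prop :=
  forall h, tens_runit (tens_map idfun phi (comul H h)) = phi h *: aone H.

(* H is cosemisimple when such a phi exists. *)
Definition normalized_integral (k : fieldType) (H : hopf_algebra k)
    (phi : {linear H -> k^o}) : Prop :=
  left_integral phi /\ phi (aone H) = 1.

(* Hom-spaces of a k-linear category have their elements in the universe of the
   elements of k-vector spaces; "small" refers to that universe throughout. *)
Notation small := (Type@{GRing.Lmodule.axioms_.u0}) (only parsing).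

Declare Scope cat_scope.
Delimit Scope cat_scope with cat.
Local Open Scope cat_scope.

Record lincat (k : fieldType) := LinCat {
  obj :> Type;
  mor : obj -> obj -> lmodType k;
  idm : forall X, mor X X;
  mcomp : forall X Y Z, mor Y Z -> mor X Y -> mor X Z;
  mcompA : forall X Y Z U (h : mor Z U) (g : mor Y Z) (f : mor X Y),
    mcomp h (mcomp g f) = mcomp (mcomp h g) f;
  comp1m : forall X Y (f : mor X Y), mcomp (idm Y) f = f;
  compm1 : forall X Y (f : mor X Y), mcomp f (idm X) = f;
  comp_bilinear : forall X Y Z, bilinear_for *:%R *:%R (@mcomp X Y Z) }.
Arguments mor {k S} X Y : rename.
Arguments idm {k S} X : rename.
Arguments mcomp {k S X Y Z} g f : rename.

Notation "g ∘ f" := (mcomp g f) (at level 40, left associativity) : cat_scope.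

Section Categories.
Variables (k : fieldType) (S : lincat k).
Implicit Types X Y Z : S.

Lemma compPl X Y Z (f : mor X Y) a (g h : mor Y Z) :
  (a *: g + h) ∘ f = a *: (g ∘ f) + h ∘ f.
Proof. exact: (comp_bilinear X Y Z).1. Qed.

Lemma compPr X Y Z (g : mor Y Z) a (f h : mor X Y) :
  g ∘ (a *: f + h) = a *: (g ∘ f) + g ∘ h.
Proof. exact: (comp_bilinear X Y Z).2. Qed.

Lemma comp0l X Y Z (f : mor X Y) : (0 : mor Y Z) ∘ f = 0.
Proof.
by have := compPl f (-1) (0 : mor Y Z) 0; rewrite scaler0 addr0 scaleN1r addNr.
Qed.

Lemma comp0r X Y Z (g : mor Y Z) : g ∘ (0 : mor X Y) = 0.
Proof.
by have := compPr g (-1) (0 : mor X Y) 0; rewrite scaler0 addr0 scaleN1r addNr.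
Qed.

Lemma compZl X Y Z (f : mor X Y) a (g : mor Y Z) : (a *: g) ∘ f = a *: (g ∘ f).
Proof. by rewrite -[a *: g]addr0 compPl comp0l addr0. Qed.

Definition mono X Y (f : mor X Y) : Prop :=
  forall Z (g h : mor Z X), f ∘ g = f ∘ h -> g = h.

Definition epi X Y (f : mor X Y) : Prop :=
  forall Z (g h : mor Y Z), g ∘ f = h ∘ f -> g = h.

Definition iso X Y (f : mor X Y) : Prop :=
  exists g : mor Y X, g ∘ f = idm X /\ f ∘ g = idm Y.

Definition is_zero X : Prop := idm X = 0.

Definition is_kernel X Y (f : mor X Y) K (i : mor K X) : Prop :=
  f ∘ i = 0 /\
  forall Z (g : mor Z X), f ∘ g = 0 -> exists! u : mor Z K, i ∘ u = g.

Definition is_cokernel X Y (f : mor X Y) C (p : mor Y C) : Prop :=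
  p ∘ f = 0 /\
  forall Z (g : mor Y Z), g ∘ f = 0 -> exists! u : mor C Z, u ∘ p = g.

Definition is_biproduct X Y P (i : mor X P) (j : mor Y P)
    (p : mor P X) (q : mor P Y) : Prop :=
  [/\ p ∘ i = idm X, q ∘ j = idm Y, q ∘ i = 0, p ∘ j = 0
    & i ∘ p + j ∘ q = idm P].

Definition is_coproduct (I : small) (F : I -> S) C
    (inj : forall i, mor (F i) C) : Prop :=
  forall Z (g : forall i, mor (F i) Z),
    exists! u : mor C Z, forall i, u ∘ inj i = g i.

(* 0 -> X -> Y -> Z -> 0 *)
Definition short_exact X Y Z (f : mor X Y) (g : mor Y Z) : Prop :=
  is_kernel g f /\ is_cokernel f g.

Record abelian : Prop := Abelian {
  abelian_zero : exists Z, is_zero Z;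
  abelian_biproduct : forall X Y, exists P (i : mor X P) (j : mor Y P)
    (p : mor P X) (q : mor P Y), is_biproduct i j p q;
  abelian_kernel : forall X Y (f : mor X Y), exists K (i : mor K X),
    is_kernel f i;
  abelian_cokernel : forall X Y (f : mor X Y), exists C (p : mor Y C),
    is_cokernel f p;
  abelian_mono : forall X Y (f : mor X Y), mono f ->
    exists Z (g : mor Y Z), is_kernel g f;
  abelian_epi : forall X Y (f : mor X Y), epi f ->
    exists Z (g : mor Z X), is_cokernel g f }.

Definition generator_obj G : Prop :=
  forall X Y (f g : mor X Y), f <> g -> exists h : mor G X, f ∘ h <> g ∘ h.

Definition injective_obj E : Prop :=
  forall X Y (m : mor X Y), mono m -> forall f : mor X E,
    exists g : mor Y E, g ∘ m = f.

Definition cogenerator_obj E : Prop :=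
  forall X Y (q : mor X Y), epi q -> ~ iso q ->
    exists f : mor X E, ~ exists g : mor Y E, g ∘ q = f.

(* Order on the subobjects of M, given by their inclusions. *)
Definition sub_le M X Y (i : mor X M) (j : mor Y M) : Prop :=
  exists u : mor X Y, j ∘ u = i.

(* j : N -> M is the sum (the least upper bound) of the subobjects of M
   satisfying P. *)
Definition is_sub_sum M (P : forall X, mor X M -> Prop) N (j : mor N M) : Prop :=
  [/\ mono j,
      forall X (i : mor X M), mono i -> P X i -> sub_le i j
    & forall L (l : mor L M), mono l ->
        (forall X (i : mor X M), mono i -> P X i -> sub_le i l) -> sub_le j l].

End Categories.

Record smallcat := SmallCat {
  sobj :> small;
  shom : sobj -> sobj -> small;
  sidm : forall i, shom i i;
  scomp : forall i j l, shom j l -> shom i j -> shom i l;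
  scompA : forall i j l m (c : shom l m) (b : shom j l) (a : shom i j),
    scomp c (scomp b a) = scomp (scomp c b) a;
  scomp1m : forall i j (a : shom i j), scomp (sidm j) a = a;
  scompm1 : forall i j (a : shom i j), scomp a (sidm i) = a }.
Arguments shom {J} i j : rename.
Arguments sidm {J} i : rename.
Arguments scomp {J i j l} b a : rename.

Definition filtered (J : smallcat) : Prop :=
  [/\ exists i : J, True,
      forall i j : J, exists l, inhabited (shom i l) /\ inhabited (shom j l)
    & forall (i j : J) (a b : shom i j), exists l (c : shom j l),
        scomp c a = scomp c b].

Record diagram (k : fieldType) (J : smallcat) (S : lincat k) := Diagram {
  dobj :> J -> S;
  dmap : forall i j, shom i j -> mor (dobj i) (dobj j);
  dmap1 : forall i, dmap (sidm i) = idm (dobj i);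
  dmap_comp : forall i j l (b : shom j l) (a : shom i j),
    dmap (scomp b a) = dmap b ∘ dmap a }.
Arguments dmap {k J S} F {i j} a : rename.

Section Diagrams.
Variables (k : fieldType) (J : smallcat) (S : lincat k).
Implicit Types F G : diagram J S.

Definition natural F G (t : forall i, mor (F i) (G i)) : Prop :=
  forall i j (a : shom i j), dmap G a ∘ t i = t j ∘ dmap F a.

Definition cocone F (C : S) (c : forall i, mor (F i) C) : Prop :=
  forall i j (a : shom i j), c j ∘ dmap F a = c i.

Definition is_colimit F (C : S) (c : forall i, mor (F i) C) : Prop :=
  cocone c /\
  forall (Z : S) (g : forall i, mor (F i) Z), cocone g ->
    exists! u : mor C Z, forall i, u ∘ c i = g i.

End Diagrams.

(* Taking colimits over J turns short exact sequences of diagrams into short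
   exact sequences. *)
Definition exact_colimits (k : fieldType) (J : smallcat) (S : lincat k) : Prop :=
  forall (F' F F'' : diagram J S)
    (s : forall i, mor (F' i) (F i)) (t : forall i, mor (F i) (F'' i)),
  natural s -> natural t -> (forall i, short_exact (s i) (t i)) ->
  forall (C' C C'' : S) (c' : forall i, mor (F' i) C')
    (c : forall i, mor (F i) C) (c'' : forall i, mor (F'' i) C''),
  is_colimit c' -> is_colimit c -> is_colimit c'' ->
  forall (f : mor C' C) (g : mor C C''),
  (forall i, f ∘ c' i = c i ∘ s i) -> (forall i, g ∘ c i = c'' i ∘ t i) ->
  short_exact f g.

Record grothendieck (k : fieldType) (S : lincat k) : Prop := Grothendieck {
  groth_abelian : abelian S;
  groth_coproducts : forall (I : small) (F : I -> S),
    exists (C : S) (inj : forall i, mor (F i) C), is_coproduct inj;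
  groth_filtered : forall J : smallcat, filtered J -> exact_colimits J S;
  groth_generator : exists G : S, generator_obj G }.

(* A choice, for every M, of a left adjoint M ⊙ - : k-Mod -> S of [mor M -], with
   unit [teta]. The object V ⊙ M is not distinguished from M ⊙ V, so [tob M V]
   also stands for the tensor product with V on the left. *)
Record tensoring (k : fieldType) (S : lincat k) := Tensoring {
  tob : S -> lmodType k -> S;
  teta : forall M (V : lmodType k), {linear V -> mor M (tob M V)};
  tlift : forall M (V : lmodType k) N, {linear V -> mor M N} -> mor (tob M V) N;
  tliftE : forall M (V : lmodType k) N (f : {linear V -> mor M N}) v,
    tlift f ∘ teta M V v = f v;
  tob_ext : forall M (V : lmodType k) N (f g : mor (tob M V) N),
    (forall v, f ∘ teta M V v = g ∘ teta M V v) -> f = g }.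
Arguments teta {k S} T {M V} : rename.
Arguments tlift {k S} T {M V N} f : rename.

Section TensorOperations.
Variables (k : fieldType) (S : lincat k) (T : tensoring S).
Local Notation "M ⊙ V" := (tob T M V) (at level 40, left associativity).
Local Notation η := (teta T).
Implicit Types (M N : S) (U V W : lmodType k).

Section Functoriality.
Variables (M N : S) (V W : lmodType k).

Lemma tmapl_linear (f : mor M N) : linear (fun v : V => η v ∘ f).
Proof. by move=> a v v'; rewrite linearP compPl. Qed.
(* f ⊙ V *)
Definition tmapl (f : mor M N) : mor (M ⊙ V) (N ⊙ V) :=
  tlift T (mklin (tmapl_linear f)).
Lemma tmaplE f v : tmapl f ∘ η v = η v ∘ f.
Proof. exact: tliftE. Qed.

Lemma tmapr_linear (f : {linear V -> W}) :
  linear (fun v : V => η (f v) : mor M (M ⊙ W)).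
Proof. by move=> a v v'; rewrite !linearP. Qed.
(* M ⊙ f *)
Definition tmapr (f : {linear V -> W}) : mor (M ⊙ V) (M ⊙ W) :=
  tlift T (mklin (tmapr_linear f)).
Lemma tmaprE f v : tmapr f ∘ η v = η (f v).
Proof. exact: tliftE. Qed.

End Functoriality.

Section Assoc.
Variables (M : S) (V W : lmodType k).

Lemma rassoc_in_linear w : linear (fun v : V => η (v ⊗ₑ w) : mor M (M ⊙ (V ⊗ W))).
Proof. by move=> a v v'; rewrite linearPl linearP. Qed.
Lemma rassoc_linear :
  linear (fun w : W => tlift T (mklin (rassoc_in_linear w))).
Proof.
move=> a w w'; apply: tob_ext => v.
by rewrite compPl !tliftE /= linearPr linearP.
Qed.
(* (M ⊗ V) ⊗ W -> M ⊗ (V ⊗ W) *)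
Definition rassoc : mor (M ⊙ V ⊙ W) (M ⊙ (V ⊗ W)) :=
  tlift T (mklin rassoc_linear).
Lemma rassocE v w : rassoc ∘ η w ∘ η v = η (v ⊗ₑ w).
Proof. by rewrite /rassoc !tliftE. Qed.

Lemma lassoc_in_linear v : linear (fun w : W => η (v ⊗ₑ w) : mor M (M ⊙ (V ⊗ W))).
Proof. by move=> a w w'; rewrite linearPr linearP. Qed.
Lemma lassoc_linear :
  linear (fun v : V => tlift T (mklin (lassoc_in_linear v))).
Proof.
move=> a v v'; apply: tob_ext => w.
by rewrite compPl !tliftE /= linearPl linearP.
Qed.
(* V ⊗ (W ⊗ M) -> (V ⊗ W) ⊗ M, where - ⊗ M is written M ⊙ - *)
Definition lassoc : mor (M ⊙ W ⊙ V) (M ⊙ (V ⊗ W)) :=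
  tlift T (mklin lassoc_linear).
Lemma lassocE v w : lassoc ∘ η v ∘ η w = η (v ⊗ₑ w).
Proof. by rewrite /lassoc !tliftE. Qed.

Lemma rassoc_inv_bilinear :
  bilinear_for *:%R *:%R
    (fun (v : V) (w : W) => η w ∘ η v : mor M (M ⊙ V ⊙ W)).
Proof.
by split=> [w a v v'|v a w w'] /=; rewrite linearP (compPl, compPr).
Qed.
(* M ⊗ (V ⊗ W) -> (M ⊗ V) ⊗ W *)
Definition rassoc_inv : mor (M ⊙ (V ⊗ W)) (M ⊙ V ⊙ W) :=
  tlift T (tens_lift (mkbil rassoc_inv_bilinear)).
Lemma rassoc_invE v w : rassoc_inv ∘ η (v ⊗ₑ w) = η w ∘ η v.
Proof. by rewrite /rassoc_inv tliftE /= tens_liftE. Qed.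

End Assoc.

Section Unit.
Variable M : S.
Lemma runit_linear : linear (fun c : k^o => c *: idm M).
Proof. by move=> a c d; rewrite scalerDl scalerA. Qed.
(* M ⊗ k -> M *)
Definition runit : mor (M ⊙ k^o) M := tlift T (mklin runit_linear).
Lemma runitE c : runit ∘ η c = c *: idm M.
Proof. exact: tliftE. Qed.
End Unit.

Section Exchange.
Variables (M : S) (U V W : lmodType k).

Lemma exchange_in_linear u v :
  linear (fun w : W => η (v ⊗ₑ w) ∘ η u : mor M (M ⊙ U ⊙ (V ⊗ W))).
Proof. by move=> a w w'; rewrite linearPr linearP compPl. Qed.
Lemma exchange_bilinear :
  bilinear_for *:%R *:%R
    (fun (u : U) (v : V) => tlift T (mklin (exchange_in_linear u v))).
Proof.
split=> [v a u u'|u a v v']; apply: tob_ext => w.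
- by rewrite compPl !tliftE /= linearP compPr.
- by rewrite compPl !tliftE /= linearPl linearP compPl.
Qed.
(* U ⊗ T ⊗ W : (U ⊗ V) ⊗ (M ⊗ W) -> (U ⊗ M) ⊗ (V ⊗ W), for the swap
   T : V ⊗ M -> M ⊗ V. *)
Definition exchange : mor (M ⊙ W ⊙ (U ⊗ V)) (M ⊙ U ⊙ (V ⊗ W)) :=
  tlift T (tens_lift (mkbil exchange_bilinear)).
Lemma exchangeE u v w :
  exchange ∘ η (u ⊗ₑ v) ∘ η w = η (v ⊗ₑ w) ∘ η u.
Proof. by rewrite /exchange tliftE /= tens_liftE /= tliftE. Qed.
End Exchange.

Lemma tens_ob_ext M V W N (f g : mor (M ⊙ (V ⊗ W)) N) :
  (forall v w, f ∘ η (v ⊗ₑ w) = g ∘ η (v ⊗ₑ w)) -> f = g.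
Proof.
move=> fg; apply: tob_ext.
have L h : linear (fun x : V ⊗ W => h ∘ η x : mor M N).
  by move=> a x y; rewrite linearP compPr.
exact: (tens_ext (f := mklin (L f)) (g := mklin (L g))).
Qed.

End TensorOperations.
Arguments tmapl {k S} T {M N} V f.
Arguments tmapr {k S} T M {V W} f.

(* A choice, for every V, of a right adjoint of - ⊙ V : S -> S, with counit
   [iev]. *)
Record internal_hom (k : fieldType) (S : lincat k) (T : tensoring S) :=
  InternalHom {
  ihom : lmodType k -> S -> S;
  iev : forall (V : lmodType k) N, mor (tob T (ihom V N) V) N;
  icurry : forall (V : lmodType k) M N, mor (tob T M V) N -> mor M (ihom V N);
  icurryE : forall (V : lmodType k) M N (f : mor (tob T M V) N),
    iev V N ∘ tmapl T V (icurry f) = f;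
  ihom_ext : forall (V : lmodType k) M N (f g : mor M (ihom V N)),
    iev V N ∘ tmapl T V f = iev V N ∘ tmapl T V g -> f = g }.
Arguments ihom {k S T} ih V N : rename.
Arguments iev {k S T} ih {V N} : rename.
Arguments icurry {k S T} ih {V M N} f : rename.

Section HopfModules.
Variables (k : fieldType) (S : lincat k) (T : tensoring S).
Variables (H : hopf_algebra k) (A : comodule_algebra H).
Local Notation "M ⊙ V" := (tob T M V) (at level 40, left associativity).
Local Notation η := (teta T).
Local Notation μA := (mulmap : {linear A ⊗ A -> A}).
Local Notation μH := (mulmap : {linear H ⊗ H -> H}).

Record module_object := ModuleObject {
  mod_obj :> S;
  act : mor (mod_obj ⊙ A) mod_obj;
  act_unit : act ∘ η (aone A) = idm mod_obj;
  act_assoc : act ∘ tmapl T A act = act ∘ tmapr T mod_obj μA ∘ lassoc T mod_obj A A }.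

Record hopf_module := HopfModule {
  hopf_mod :> module_object;
  coact : mor hopf_mod (hopf_mod ⊙ H);
  coact_assoc : rassoc T hopf_mod H H ∘ tmapl T H coact ∘ coact =
    tmapr T hopf_mod (comul H) ∘ coact;
  coact_counit : runit T hopf_mod ∘ tmapr T hopf_mod (counit H) ∘ coact =
    idm hopf_mod;
  coact_act : coact ∘ act hopf_mod =
    tmapl T H (act hopf_mod) ∘ tmapr T (hopf_mod ⊙ A) μH
      ∘ exchange T hopf_mod A H H
      ∘ tmapr T (hopf_mod ⊙ H) (acoact A) ∘ tmapl T A coact }.

Section Hom.
Variables M N : hopf_module.

Definition is_hopf_hom (f : mor M N) : Prop :=
  f ∘ act M = act N ∘ tmapl T A f /\ coact N ∘ f = tmapl T H f ∘ coact M.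

Lemma tmapl_lin (X Y : S) (V : lmodType k) a (f g : mor X Y) :
  tmapl T V (a *: f + g) = a *: tmapl T V f + tmapl T V g.
Proof. by apply: tob_ext => v; rewrite compPl !tmaplE compPr. Qed.

Definition hopf_hom_pred : {pred mor M N} := fun f => `[< is_hopf_hom f >].

Lemma hopf_hom_closed : submod_closed hopf_hom_pred.
Proof.
have tmapl0 (X Y : S) (V : lmodType k) : tmapl T V (0 : mor X Y) = 0.
  by have := tmapl_lin V (-1) (0 : mor X Y) 0;
    rewrite scaler0 addr0 scaleN1r addNr.
split=> [|a f g /asboolP[f1 f2] /asboolP[g1 g2]]; apply/asboolP; split.
- by rewrite tmapl0 comp0l comp0r.
- by rewrite tmapl0 comp0l comp0r.
- by rewrite compPl f1 g1 tmapl_lin compPr.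
- by rewrite compPr f2 g2 tmapl_lin compPl.
Qed.
HB.instance Definition _ :=
  GRing.isSubmodClosed.Build k (mor M N) hopf_hom_pred hopf_hom_closed.

Record hopf_hom := HopfHom {
  hopf_hom_val :> mor M N;
  hopf_hom_valP : hopf_hom_val \in hopf_hom_pred }.

HB.instance Definition _ := [isSub for hopf_hom_val].
HB.instance Definition _ := [Choice of hopf_hom by <:].
HB.instance Definition _ := [SubChoice_isSubLmodule of hopf_hom by <:].

Lemma hopf_homP (f : hopf_hom) : is_hopf_hom f.
Proof. exact/asboolP/hopf_hom_valP. Qed.

Definition mk_hopf_hom (f : mor M N) (fP : is_hopf_hom f) : hopf_hom :=
  HopfHom (introT (asboolP _) fP).

End Hom.

Lemma is_hopf_hom_id M : is_hopf_hom (M := M) (N := M) (idm M).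
Proof.
have E V : tmapl T V (idm M) = idm (M ⊙ V).
  by apply: tob_ext => v; rewrite tmaplE compm1 comp1m.
by split; rewrite E ?comp1m ?compm1.
Qed.

Lemma tmapl_comp (X Y Z : S) (V : lmodType k) (g : mor Y Z) (f : mor X Y) :
  tmapl T V (g ∘ f) = tmapl T V g ∘ tmapl T V f.
Proof. by apply: tob_ext => v; rewrite tmaplE -mcompA tmaplE !mcompA tmaplE. Qed.

Lemma is_hopf_hom_comp M N P (g : hopf_hom N P) (f : hopf_hom M N) :
  is_hopf_hom (M := M) (N := P) ((g : mor N P) ∘ (f : mor M N)).
Proof.
have [f1 f2] := hopf_homP f; have [g1 g2] := hopf_homP g.
split; rewrite tmapl_comp.
- by rewrite -mcompA f1 !mcompA g1.
- by rewrite mcompA g2 -!mcompA f2.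
Qed.

Definition hopf_idm M : hopf_hom M M := mk_hopf_hom (is_hopf_hom_id M).
Definition hopf_comp M N P (g : hopf_hom N P) (f : hopf_hom M N) :
  hopf_hom M P := mk_hopf_hom (is_hopf_hom_comp g f).

Lemma hopf_compA M N P Q (h : hopf_hom P Q) (g : hopf_hom N P)
    (f : hopf_hom M N) :
  hopf_comp h (hopf_comp g f) = hopf_comp (hopf_comp h g) f.
Proof. by apply: val_inj; rewrite /= mcompA. Qed.
Lemma hopf_comp1m M N (f : hopf_hom M N) : hopf_comp (hopf_idm N) f = f.
Proof. by apply: val_inj; rewrite /= comp1m. Qed.
Lemma hopf_compm1 M N (f : hopf_hom M N) : hopf_comp f (hopf_idm M) = f.
Proof. by apply: val_inj; rewrite /= compm1. Qed.
Lemma hopf_comp_bilinear M N P : bilinear_for *:%R *:%R (@hopf_comp M N P).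
Proof.
by split=> [f a g h|g a f h]; apply: val_inj; rewrite /= (compPl, compPr).
Qed.

(* The category of left-right relative (A, H)-Hopf module objects in S. *)
Definition hopf_cat : lincat k :=
  LinCat hopf_compA hopf_comp1m hopf_compm1 hopf_comp_bilinear.

Definition forget (M N : hopf_cat) (f : mor M N) :
  mor (M : hopf_module) (N : hopf_module) := hopf_hom_val f.

End HopfModules.

Section Constructions.
Variables (k : fieldType) (S : lincat k) (T : tensoring S).
Variables (H : hopf_algebra k) (A : comodule_algebra H).
Local Notation "M ⊙ V" := (tob T M V) (at level 40, left associativity).
Local Notation η := (teta T).
Local Notation μA := (mulmap : {linear A ⊗ A -> A}).
Local Notation μH := (mulmap : {linear H ⊗ H -> H}).

Lemma mulmapE (B : algebra k) (b c : B) : mulmap (b ⊗ₑ c) = amul b c.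
Proof. exact: tens_liftE. Qed.

Lemma tmaplEr (X Y Z : S) (V : lmodType k) (g : mor (Y ⊙ V) Z) (f : mor X Y)
  (v : V) : g ∘ tmapl T V f ∘ η v = g ∘ η v ∘ f.
Proof. by rewrite -mcompA tmaplE mcompA. Qed.

Lemma tmaprEr (X Z : S) (V W : lmodType k) (g : mor (X ⊙ W) Z)
  (f : {linear V -> W}) (v : V) : g ∘ tmapr T X f ∘ η v = g ∘ η (f v).
Proof. by rewrite -mcompA tmaprE. Qed.

Lemma lassocEr (X Z : S) (V W : lmodType k) (g : mor (X ⊙ (V ⊗ W)) Z) v w :
  g ∘ lassoc T X V W ∘ η v ∘ η w = g ∘ η (v ⊗ₑ w).
Proof. by rewrite -2!mcompA (mcompA (lassoc _ _ _ _)) lassocE. Qed.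

Lemma rassocEr (X Z : S) (V W : lmodType k) (g : mor (X ⊙ (V ⊗ W)) Z) v w :
  g ∘ rassoc T X V W ∘ η w ∘ η v = g ∘ η (v ⊗ₑ w).
Proof. by rewrite -2!mcompA (mcompA (rassoc _ _ _ _)) rassocE. Qed.

Lemma rassoc_invEr (X Z : S) (V W : lmodType k) (g : mor (X ⊙ V ⊙ W) Z) v w :
  g ∘ rassoc_inv T X V W ∘ η (v ⊗ₑ w) = g ∘ η w ∘ η v.
Proof. by rewrite -mcompA rassoc_invE mcompA. Qed.

Lemma exchangeEr (X Z : S) (U V W : lmodType k)
    (g : mor (X ⊙ U ⊙ (V ⊗ W)) Z) u v w :
  g ∘ exchange T X U V W ∘ η (u ⊗ₑ v) ∘ η w = g ∘ η (v ⊗ₑ w) ∘ η u.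
Proof. by rewrite -2!mcompA (mcompA (exchange _ _ _ _ _)) exchangeE mcompA. Qed.

Let tmE := (tmaplE, tmaprE, tmaplEr, tmaprEr).

Local Ltac lin := by move=> ? ? ?; rewrite ?(linearP, compPl, compPr).

(* The coaction M ⊗ Δ_H of M ⊗ H. *)
Definition cofree_coact (M : S) : mor (M ⊙ H) (M ⊙ H ⊙ H) :=
  rassoc_inv T M H H ∘ tmapr T M (comul H).

Lemma cofree_coactE M h :
  cofree_coact M ∘ η h = rassoc_inv T M H H ∘ η (comul H h).
Proof. by rewrite /cofree_coact tmE. Qed.

Lemma cofree_coact_assoc (M : S) :
  rassoc T (M ⊙ H) H H ∘ tmapl T H (cofree_coact M) ∘ cofree_coact M =
  tmapr T (M ⊙ H) (comul H) ∘ cofree_coact M.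
Proof.
move: (cofree_coact M) (@cofree_coactE M) => cc ccE.
apply: tob_ext => h; rewrite -!mcompA !ccE !mcompA.
pose P (t : H ⊗ (H ⊗ H)) := rassoc_inv T M H (H ⊗ H) ∘ η t.
have EL (t : H ⊗ H) :
    rassoc T (M ⊙ H) H H ∘ tmapl T H cc ∘ rassoc_inv T M H H ∘ η t
    = P (tens_assoc (tens_map (comul H) idfun t)).
  move: t; apply: tens_ext_fun; [lin|rewrite /P; lin|move=> x y].
  rewrite -!mcompA rassoc_invE !mcompA tmE -!mcompA ccE tens_mapE /=.
  move: (comul H x); apply: tens_ext_fun; [lin| |move=> u v].
    by move=> c s t; rewrite /P linearPl !linearP compPr.
  by rewrite rassoc_invE !mcompA rassocE tens_assocE /P rassoc_invE.
have ER (t : H ⊗ H) :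
    tmapr T (M ⊙ H) (comul H) ∘ rassoc_inv T M H H ∘ η t
    = P (tens_map idfun (comul H) t).
  move: t; apply: tens_ext_fun; [lin|rewrite /P; lin|move=> x y].
  by rewrite -!mcompA rassoc_invE !mcompA tmE tens_mapE /P rassoc_invE.
by rewrite EL ER comulA.
Qed.

Lemma cofree_coact_counit (M : S) :
  runit T (M ⊙ H) ∘ tmapr T (M ⊙ H) (counit H) ∘ cofree_coact M =
  idm (M ⊙ H).
Proof.
move: (cofree_coact M) (@cofree_coactE M) => cc ccE.
apply: tob_ext => h; rewrite -!mcompA !ccE !mcompA comp1m.
rewrite -[in RHS](comul_counitr h).
move: (comul H h); apply: tens_ext_fun; [lin|lin|move=> x y].
rewrite -!mcompA rassoc_invE !mcompA tmE runitE tens_mapE tens_runitE.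
by rewrite compZl comp1m linearZ.
Qed.

Section Free.
Variable M : module_object T A.

Definition free_pre : mor (M ⊙ H ⊙ (A ⊗ H)) (M ⊙ H) :=
  tmapl T H (act M) ∘ tmapr T (M ⊙ A) μH ∘ exchange T M A H H.

Lemma free_preE a g h :
  free_pre ∘ η (a ⊗ₑ g) ∘ η h = η (amul g h) ∘ act M ∘ η a.
Proof. by rewrite /free_pre exchangeEr !tmE mulmapE. Qed.

Definition free_act : mor (M ⊙ H ⊙ A) (M ⊙ H) :=
  free_pre ∘ tmapr T (M ⊙ H) (acoact A).

Lemma free_actE a : free_act ∘ η a = free_pre ∘ η (acoact A a).
Proof. by rewrite /free_act tmE. Qed.

Lemma act_assocE (N : module_object T A) (a b : A) :
  act N ∘ η b ∘ act N ∘ η a = act N ∘ η (amul b a).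
Proof.
have := congr1 (fun f => f ∘ η b ∘ η a) (act_assoc N).
by rewrite tmE lassocEr tmE mulmapE.
Qed.

Lemma free_act_unit : free_act ∘ η (aone A) = idm (M ⊙ H).
Proof.
move: free_act free_actE => fa faE.
apply: tob_ext => h.
by rewrite faE acoact1 free_preE amul1l -mcompA act_unit compm1 comp1m.
Qed.

Lemma free_preM (s t : A ⊗ H) h :
  free_pre ∘ η s ∘ free_pre ∘ η t ∘ η h = free_pre ∘ η (tens_amul s t) ∘ η h.
Proof.
move: free_pre free_preE => fp fpE.
move: s; apply: tens_ext_fun; [lin| |move=> b g].
  by move=> c s s'; rewrite tens_amul_linear_l linearP compPr compPl.
move: t; apply: tens_ext_fun; [lin| |move=> a g'].
  by move=> c t t'; rewrite tens_amul_linear_r linearP compPr compPl.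
have fpEr (g0 : mor (M ⊙ H) (M ⊙ H)) c x y :
    g0 ∘ fp ∘ η (c ⊗ₑ x) ∘ η y = g0 ∘ η (amul x y) ∘ act M ∘ η c.
  by rewrite -2!mcompA (mcompA fp) fpE !mcompA.
by rewrite tens_amulE fpEr !fpE -amulA -[RHS]mcompA -act_assocE !mcompA.
Qed.

Lemma free_act_assoc :
  free_act ∘ tmapl T A free_act =
  free_act ∘ tmapr T (M ⊙ H) μA ∘ lassoc T (M ⊙ H) A A.
Proof.
have fpM := free_preM.
move: free_act free_actE => fa faE.
move: free_pre fpM faE => fp fpM faE.
apply: tob_ext => b; apply: tob_ext => a; apply: tob_ext => h.
rewrite tmE lassocEr tmE mulmapE !faE acoactM -fpM.
by rewrite -!(mcompA _ fa) faE !mcompA.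
Qed.

Definition free_module : module_object T A :=
  ModuleObject free_act_unit free_act_assoc.

Lemma free_coact_act :
  cofree_coact M ∘ free_act =
    tmapl T H free_act ∘ tmapr T (M ⊙ H ⊙ A) μH
      ∘ exchange T (M ⊙ H) A H H
      ∘ tmapr T (M ⊙ H ⊙ H) (acoact A) ∘ tmapl T A (cofree_coact M).
Proof.
move: (cofree_coact M) (@cofree_coactE M) => cc ccE.
move: free_act free_actE => fa faE.
move: free_pre free_preE faE => fp fpE faE.
have ccEr Z (g : mor (M ⊙ H ⊙ H) Z) h :
    g ∘ cc ∘ η h = g ∘ rassoc_inv T M H H ∘ η (comul H h).
  by rewrite -mcompA ccE mcompA.
have faEr Z (g : mor (M ⊙ H) Z) a : g ∘ fa ∘ η a = g ∘ fp ∘ η (acoact A a).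
  by rewrite -mcompA faE mcompA.
have fpEr Z (g : mor (M ⊙ H) Z) a x y :
    g ∘ fp ∘ η (a ⊗ₑ x) ∘ η y = g ∘ η (amul x y) ∘ act M ∘ η a.
  by rewrite -2!mcompA (mcompA fp) fpE !mcompA.
apply: tob_ext => a; apply: tob_ext => h; rewrite !tmE ccEr faEr.
have Q_bil t : bilinear_for *:%R *:%R (fun (a : A) (z : H ⊗ H) =>
    rassoc_inv T M H H ∘ η (tens_amul z t) ∘ act M ∘ η a).
  split=> [z c x y|x c z z'] /=; first by rewrite linearP compPr.
  by rewrite tens_amul_linear_l linearP compPr !compPl.
pose Q t := tens_lift (mkbil (Q_bil t)).
have EL (s : A ⊗ H) :
    cc ∘ fp ∘ η s ∘ η h = Q (comul H h) (tens_map idfun (comul H) s).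
  move: s; apply: tens_ext_fun; [lin|rewrite /Q; lin|move=> b g].
  by rewrite fpEr ccE tens_mapE /Q tens_liftE /= comulM.
have ER (s : A ⊗ H) (t : H ⊗ H) :
    tmapl T H fa ∘ tmapr T (M ⊙ H ⊙ A) μH ∘ exchange T (M ⊙ H) A H H
      ∘ η s ∘ rassoc_inv T M H H ∘ η t =
    Q t (tens_assoc (tens_map (acoact A) idfun s)).
  move: s; apply: tens_ext_fun; [lin|rewrite /Q; lin|move=> b g].
  rewrite tens_mapE /=; have bu Z (g0 : mor (M ⊙ H) Z) := faEr Z g0 b.
  move: (acoact A b) bu => u bu.
  move: t; apply: tens_ext_fun; [lin| |move=> x y].
    move=> c t t'; move: (tens_assoc _) => z; move: z.
    apply: tens_ext_fun; [rewrite /Q; lin| |move=> d z].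
      by move=> e z z'; rewrite /Q !linearP /= !scalerA [c * e]mulrC addrACA.
    by rewrite /Q !tens_liftE /= tens_amul_linear_r linearP compPr !compPl.
  rewrite rassoc_invEr exchangeEr !tmE mulmapE bu.
  move: u {bu}; apply: tens_ext_fun; [lin| |move=> d g'].
    by move=> c s s'; rewrite /Q linearPl !linearP.
  by rewrite fpEr tens_assocE /Q tens_liftE /= tens_amulE rassoc_invE.
by rewrite EL ER acoactA.
Qed.

(* M ⊗ H *)
Definition free_hopf : hopf_module T A :=
  HopfModule (hopf_mod := free_module)
    (cofree_coact_assoc M) (cofree_coact_counit M) free_coact_act.

End Free.

Section IHom.
Variables (ih : internal_hom T) (N : S).
Local Notation P := (ihom ih A N).

(* Informally, (a f)(x) = f(x a). *)
Definition ihom_act : mor (P ⊙ A) P :=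
  icurry ih (iev ih ∘ tmapr T P μA ∘ lassoc T P A A).

Lemma ihom_actE x a : iev ih ∘ η x ∘ ihom_act ∘ η a = iev ih ∘ η (amul x a : A).
Proof.
have := congr1 (fun f => f ∘ η x ∘ η a)
  (icurryE ih (iev ih ∘ tmapr T P μA ∘ lassoc T P A A)).
by rewrite tmE lassocEr tmE mulmapE.
Qed.

Lemma ihom_ext_elt (X : S) (f g : mor X P) :
  (forall x : A, iev ih ∘ η x ∘ f = iev ih ∘ η x ∘ g) -> f = g.
Proof. by move=> fg; apply: ihom_ext; apply: tob_ext => x; rewrite !tmE. Qed.

Lemma ihom_act_unit : ihom_act ∘ η (aone A) = idm P.
Proof.
move: ihom_act ihom_actE => ia iaE.
by apply: ihom_ext_elt => x; rewrite mcompA iaE amul1r compm1.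
Qed.

Lemma ihom_act_assoc :
  ihom_act ∘ tmapl T A ihom_act = ihom_act ∘ tmapr T P μA ∘ lassoc T P A A.
Proof.
move: ihom_act ihom_actE => ia iaE.
apply: ihom_ext_elt => x; apply: tob_ext => b; apply: tob_ext => a.
by rewrite !mcompA tmE lassocEr tmE mulmapE !iaE amulA.
Qed.

(* Hom(A, N) *)
Definition ihom_module : module_object T A :=
  ModuleObject ihom_act_unit ihom_act_assoc.

End IHom.

Section Radical.
Variables (phi : {linear H -> k^o}) (M : hopf_cat T A).

(* (M ⊗ φ) ∘ Δ_M : M -> M *)
Definition integral_map : mor (M : hopf_module T A) (M : hopf_module T A) :=
  runit T (M : hopf_module T A) ∘ tmapr T (M : hopf_module T A) phi ∘ coact M.

(* The subobject i of M in the category of Hopf modules is contained, as a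
   subobject in S, in the kernel of [integral_map]. *)
Definition sub_KH (X : hopf_cat T A) (i : mor X M) : Prop :=
  exists (K : S) (j : mor K (M : hopf_module T A)),
    is_kernel integral_map j /\ sub_le (forget i) j.

Definition is_AKH (N : hopf_cat T A) (j : mor N M) : Prop :=
  is_sub_sum sub_KH j.

Definition in_F : Prop :=
  exists (N : hopf_cat T A) (j : mor N M), is_AKH j /\ is_zero N.

End Radical.

End Constructions.

(* Main.v *)
(* A map f : M -> I in S extends to a Hopf module map M -> Hom(A, I) ⊗ H,
   x ↦ (a ↦ f(a x_0)) ⊗ x_1, from which f is recovered by evaluating at 1 and
   applying the counit. The map (M ⊗ φ) ∘ Δ_M is natural in M; if it vanishes on
   M, then it vanishes on the image of this extension, which is therefore 0 by
   the hypothesis on Hom(A, I) ⊗ H. So every f is 0, and M = 0 as I is a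
   cogenerator. Images in S of Hopf module maps are Hopf submodules because
   - ⊗ H preserves monomorphisms. *)
Require Import Defs.
From mathcomp Require Import all_boot all_algebra.
From mathcomp Require Import boolp classical_sets.

Set Implicit Arguments.
Unset Strict Implicit.
Unset Printing Implicit Defensive.

Import GRing.Theory.
Local Open Scope ring_scope.
Local Open Scope tensor_scope.
Local Open Scope cat_scope.

(** * Sections of linear surjections *)

Lemma linear_surj_section (k : fieldType) (U W : lmodType k)
    (p : {linear U -> W}) :
  (forall w, exists u, p u = w) -> exists s : {linear W -> U}, cancel s p.
Proof.
move=> p_surj.
(* A subspace of U maximal among those meeting ker p trivially is a complement
   of ker p. *)
pose disj (C : set U) :=
  (forall a x y, C x -> C y -> C (a *: x + y)) /\
  (forall x, C x -> p x = 0 -> x = 0).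
have [C [[linC C_ker] maxC]] :
    exists C, disj C /\ forall B, (C `<` B)%classic -> ~ disj B.
  apply: Zorn_bigcup => F FP totF.
  split=> [a x y [X FX Xx] [Y FY Yy]|x [X FX Xx]]; last exact: (FP X FX).2.
  have [XY|YX] := totF X Y FX FY.
    by exists Y => //; apply: (FP Y FY).1 => //; apply: XY.
  by exists X => //; apply: (FP X FX).1 => //; apply: YX.
(* [disj] does not ask for 0, so the union of the empty chain satisfies it. A maximal [C] without 0
   would be empty, and {0} would be larger. *)
have C0 : C 0.
  apply: contrapT => N0; apply: (maxC [set 0]%classic).
    split=> [x Cx|]; last by move=> /(_ 0); apply: contra_not N0; apply.
    by case: N0; rewrite -(addNr x) -scaleN1r; apply: linC.
  by split=> [a _ _ -> ->|x ->]; rewrite ?scaler0 ?addr0.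
(* If [C] misses [w], adjoin the line of a preimage [u]: a kernel element [a *: u + x] with [a]
   nonzero would make [- a^-1 *: x] a preimage of [w] in [C]. *)
have C_surj w : exists c, C c /\ p c = w.
  have [u pu] := p_surj w; apply: contrapT => Nw.
  apply: (maxC [set y | exists a c, C c /\ y = a *: u + c]%classic).
    split=> [x Cx|]; first by exists 0, x; rewrite scale0r add0r.
    move=> /(_ u) Cu; apply: Nw; exists u; split=> //; apply: Cu.
    by exists 1, 0; rewrite scale1r addr0.
  split=> [a _ _ [b [x [Cx ->]]] [c [y [Cy ->]]]|_ [a [x [Cx ->]]]].
    exists (a * b + c), (a *: x + y); split; first exact: linC.
    by rewrite scalerDr scalerDl !scalerA addrACA.
  have [->|a0] := eqVneq a 0; first by rewrite scale0r add0r; apply: C_ker.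
  rewrite linearP pu => aw; case: Nw; exists (- a^-1 *: x).
  have pw : p x = - (a *: w) by apply/eqP; rewrite -addr_eq0 addrC aw.
  split; first by rewrite -[_ *: x]addr0; apply: linC.
  by rewrite linearZ /= pw scalerN scaleNr opprK scalerA mulVf // scale1r.
have inj x y : C x -> C y -> p x = p y -> x = y.
  move=> Cx Cy pxy; apply/eqP; rewrite -subr_eq0 -scaleN1r addrC; apply/eqP.
  by apply: C_ker; [apply: linC|rewrite linearP pxy scaleN1r addNr].
have [s sP] := choice C_surj.
(* Preimages in [C] are unique, which forces the chosen ones to depend linearly on [w]. *)
have sL : linear s.
  move=> a x y; apply: inj; first exact: (sP _).1.
    by apply: linC; [exact: (sP _).1|exact: (sP _).1].
  by rewrite linearP !(sP _).2.
by exists (mklin sL) => w; rewrite /= (sP _).2.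
Qed.

(** * Images in an abelian category; monos and epis under - ⊗ V *)

Section Abelian.
Variables (k : fieldType) (S : lincat k).
Implicit Types X Y Z : S.

Lemma comp_linear_l X Y Z (f : mor X Y) : linear (fun g : mor Y Z => g ∘ f).
Proof. by move=> a g h; rewrite compPl. Qed.

Lemma compBr X Y Z (g : mor Y Z) (f h : mor X Y) :
  g ∘ (f - h) = g ∘ f - g ∘ h.
Proof. by rewrite addrC -scaleN1r compPr scaleN1r addrC. Qed.

Lemma compBl X Y Z (f : mor X Y) (g h : mor Y Z) :
  (g - h) ∘ f = g ∘ f - h ∘ f.
Proof. by rewrite addrC -scaleN1r compPl scaleN1r addrC. Qed.

Lemma mono_of_ker0 X Y (m : mor X Y) :
  (forall Z (f : mor Z X), m ∘ f = 0 -> f = 0) -> mono m.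
Proof.
move=> m0 Z g h mgh; apply/eqP; rewrite -subr_eq0; apply/eqP; apply: m0.
by rewrite compBr mgh subrr.
Qed.

Lemma epi_of_coker0 X Y (e : mor X Y) :
  (forall Z (f : mor Y Z), f ∘ e = 0 -> f = 0) -> epi e.
Proof.
move=> e0 Z g h geh; apply/eqP; rewrite -subr_eq0; apply/eqP; apply: e0.
by rewrite compBl geh subrr.
Qed.

Lemma mono_comp X Y Z (g : mor Y Z) (f : mor X Y) :
  mono g -> mono f -> mono (g ∘ f).
Proof. by move=> gm fm W a b; rewrite -!mcompA => /gm /fm. Qed.

Lemma kernel_mono X Y (f : mor X Y) K (i : mor K X) : is_kernel f i -> mono i.
Proof.
move=> [fi0 univ] Z g h igh.
have fig0 : f ∘ (i ∘ g) = 0 by rewrite mcompA fi0 comp0l.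
have [u [_ u_uniq]] := univ _ _ fig0.
by rewrite -(u_uniq g) // -(u_uniq h).
Qed.

Lemma cokernel_epi X Y (f : mor X Y) C (p : mor Y C) : is_cokernel f p -> epi p.
Proof.
move=> [pf0 univ] Z g h gph.
have gpf0 : g ∘ p ∘ f = 0 by rewrite -mcompA pf0 comp0r.
have [u [_ u_uniq]] := univ _ _ gpf0.
by rewrite -(u_uniq g) // -(u_uniq h).
Qed.

Lemma kernel_factor X Y (f : mor X Y) K (i : mor K X) Z (g : mor Z X) :
  is_kernel f i -> f ∘ g = 0 -> exists u, i ∘ u = g.
Proof. by move=> [_ univ] /univ [u [iu _]]; exists u. Qed.

Lemma cokernel_factor X Y (f : mor X Y) C (p : mor Y C) Z (g : mor Y Z) :
  is_cokernel f p -> g ∘ f = 0 -> exists u, u ∘ p = g.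
Proof. by move=> [_ univ] /univ [u [iu _]]; exists u. Qed.

Hypothesis S_abelian : abelian S.

(* The image is the kernel m of the cokernel q of g. If u kills e, then g factors
   through the subobject [ker u], so q annihilates it only if it is everything. *)
Lemma image_exists X Y (g : mor X Y) :
  exists Z C (m : mor Z Y) (e : mor X Z) (q : mor Y C),
    [/\ m ∘ e = g, is_kernel q m & epi e].
Proof.
have [C [q qP]] := abelian_cokernel S_abelian g.
have [Z [m mP]] := abelian_kernel S_abelian q.
have [e eP] := kernel_factor mP qP.1.
exists Z, C, m, e, q; split=> //; apply: epi_of_coker0 => W u ue0.
have [N [n nP]] := abelian_kernel S_abelian u.
have [e' e'P] := kernel_factor nP ue0.
have [R [r rP]] :=
  abelian_mono S_abelian (mono_comp (kernel_mono mP) (kernel_mono nP)).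
have rg0 : r ∘ g = 0 by rewrite -eP -e'P !mcompA -(mcompA r) rP.1 comp0l.
have [r' r'P] := cokernel_factor qP rg0.
have rm0 : r ∘ m = 0 by rewrite -r'P -mcompA mP.1 comp0r.
have [t tP] := kernel_factor rP rm0.
have nt : n ∘ t = idm Z by apply: (kernel_mono mP); rewrite mcompA tP compm1.
by rewrite -(compm1 u) -nt mcompA nP.1 comp0l.
Qed.

(** Every map to [E] that kills [f] factors through the cokernel [q] of [f], so [q] must be an
    isomorphism. *)
Lemma cogenerator_separates (E : S) : cogenerator_obj E ->
  forall X Y (f : mor X Y), (forall h : mor Y E, h ∘ f = 0) -> f = 0.
Proof.
move=> E_cogen X Y f f0.
have [C [q qP]] := abelian_cokernel S_abelian f.
have [[r [rq _]]|Niso] := EM (iso q).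
  by rewrite -(comp1m f) -rq -mcompA qP.1 comp0r.
have [h []] := E_cogen _ _ q (cokernel_epi qP) Niso.
exact: cokernel_factor qP (f0 h).
Qed.

Variables (T : tensoring S) (E : S).
Hypotheses (E_inj : injective_obj E) (E_cogen : cogenerator_obj E).

(* A map out of X ⊗ V to E is a linear map from V to Hom(X, E); as
   Hom(Y, E) -> Hom(X, E) is a split surjection, it extends to Y ⊗ V. *)
Lemma tmapl_mono X Y (V : lmodType k) (m : mor X Y) :
  mono m -> mono (tmapl T V m).
Proof.
move=> m_mono.
have [s sP] := linear_surj_section (p := mklin (@comp_linear_l X Y E m))
  (fun f => E_inj m_mono f).
apply: mono_of_ker0 => Z f mf0; apply: (cogenerator_separates E_cogen) => h.
have hL : linear (fun v : V => h ∘ teta T v) by move=> a v w; rewrite linearP compPr.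
have -> : h = tlift T (s \o mklin hL) ∘ tmapl T V m.
  apply: tob_ext => v; rewrite tmaplEr tliftE /=.
  exact: esym (sP (h ∘ teta T v)).
by rewrite -mcompA mf0 comp0r.
Qed.

Lemma tmapl_epi X Y (V : lmodType k) (e : mor X Y) :
  epi e -> epi (tmapl T V e).
Proof.
move=> e_epi Z f g fe_ge; apply: tob_ext => v; apply: e_epi.
by rewrite -!tmaplEr fe_ge.
Qed.

End Abelian.

(** * Naturality of the structure maps *)

Section Hopf.
Variables (k : fieldType) (S : lincat k) (T : tensoring S).
Variables (H : hopf_algebra k) (A : comodule_algebra H).
Local Notation "M ⊙ V" := (tob T M V) (at level 40, left associativity).
Local Notation η := (teta T).
Implicit Types X Y Z : S.

Lemma tmaplr X Y (V W : lmodType k) (f : mor X Y) (g : {linear V -> W}) :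
  tmapl T W f ∘ tmapr T X g = tmapr T Y g ∘ tmapl T V f.
Proof. by apply: tob_ext => v; rewrite tmaprEr tmaplEr tmaplE tmaprE. Qed.

Lemma runit_natural X Y (f : mor X Y) :
  runit T Y ∘ tmapl T k^o f = f ∘ runit T X.
Proof.
apply: tob_ext => c; rewrite tmaplEr runitE -mcompA runitE compZl comp1m.
by rewrite -[c *: idm X]addr0 compPr comp0r compm1 addr0.
Qed.

Lemma rassoc_natural X Y (V W : lmodType k) (f : mor X Y) :
  rassoc T Y V W ∘ tmapl T W (tmapl T V f) = tmapl T (V ⊗ W) f ∘ rassoc T X V W.
Proof.
apply: tob_ext => w; apply: tob_ext => v.
by rewrite tmaplEr -(mcompA (_ ∘ _)) tmaplE mcompA !rassocE rassocEr tmaplE.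
Qed.

Lemma rassocK X (V W : lmodType k) :
  rassoc_inv T X V W ∘ rassoc T X V W = idm _.
Proof.
apply: tob_ext => w; apply: tob_ext => v.
by rewrite rassocEr rassoc_invE comp1m.
Qed.

Lemma lassoc_natural X Y (V W : lmodType k) (f : mor X Y) :
  lassoc T Y V W ∘ tmapl T V (tmapl T W f) = tmapl T (V ⊗ W) f ∘ lassoc T X V W.
Proof.
apply: tob_ext => w; apply: tob_ext => v.
by rewrite tmaplEr -(mcompA (_ ∘ _)) tmaplE mcompA !lassocE lassocEr tmaplE.
Qed.

Lemma exchange_natural X Y (U V W : lmodType k) (f : mor X Y) :
  exchange T Y U V W ∘ tmapl T (U ⊗ V) (tmapl T W f) =
  tmapl T (V ⊗ W) (tmapl T U f) ∘ exchange T X U V W.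
Proof.
apply: tens_ob_ext => u v; apply: tob_ext => w.
rewrite tmaplEr -(mcompA (_ ∘ _)) tmaplE mcompA exchangeE exchangeEr tmaplE.
by rewrite -!mcompA tmaplE.
Qed.

Lemma integral_map_natural (phi : {linear H -> k^o}) (M N : hopf_cat T A)
    (f : mor M N) :
  integral_map phi N ∘ forget f = forget f ∘ integral_map phi M.
Proof.
rewrite /integral_map -mcompA (hopf_homP f).2 !mcompA -(mcompA (runit _ _)).
by rewrite -tmaplr !mcompA runit_natural.
Qed.

Hypothesis S_abelian : abelian S.
Variable E : S.
Hypotheses (E_inj : injective_obj E) (E_cogen : cogenerator_obj E).

(** * Hopf module structure on the image of a Hopf module map *)

Section Image.
Variables (M N : hopf_module T A) (g : hopf_hom M N).
Variables (Y C : S) (m : mor Y N) (e : mor M Y) (q : mor N C).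
Hypotheses (meg : m ∘ e = g) (mP : is_kernel q m) (e_epi : epi e).

Let m_mono : mono m := kernel_mono mP.
Let mH_mono (V : lmodType k) : mono (tmapl T V m) :=
  tmapl_mono S_abelian E_inj E_cogen m_mono.

(** As [m] is the kernel of [q], it suffices that [q] kills the right-hand side; this is checked
    after the epi [e] ⊗ A, where it follows from [q ∘ m = 0]. *)
Lemma image_act_exists :
  exists a : mor (Y ⊙ A) Y, m ∘ a = act N ∘ tmapl T A m.
Proof.
apply: (kernel_factor mP); apply: (tmapl_epi (T := T) (V := A) e_epi).
rewrite comp0l -!mcompA -tmapl_comp meg -(hopf_homP g).1 -meg !mcompA.
by rewrite mP.1 !comp0l.
Qed.

(** Dually, [e] is the cokernel of some [i], and the right-hand side kills [i] because it does so
    after the mono [m] ⊗ H. *)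
Lemma image_coact_exists :
  exists c : mor Y (Y ⊙ H), c ∘ e = tmapl T H e ∘ coact M.
Proof.
have [K [i iP]] := abelian_epi S_abelian e_epi.
apply: (cokernel_factor iP); apply: mH_mono.
rewrite comp0r !mcompA -tmapl_comp meg -(hopf_homP g).2 -meg -!mcompA.
by rewrite iP.1 !comp0r.
Qed.

(** The module axioms are inherited from [N] by cancelling [m], the comodule axioms from [M] by
    cancelling [e], and their compatibility from [M] by cancelling [e] ⊗ A. *)
Lemma image_hopf :
  exists (Q : hopf_module T A) (m' : hopf_hom Q N) (e' : hopf_hom M Q),
    [/\ hopf_comp m' e' = g, mono (m' : mor Q N) & epi (e' : mor M Q)].
Proof.
have [a aP] := image_act_exists; have [c cP] := image_coact_exists.
have aeP : a ∘ tmapl T A e = e ∘ act M.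
  apply: m_mono.
  by rewrite !mcompA aP meg (hopf_homP g).1 -mcompA -tmapl_comp meg.
have cmP : coact N ∘ m = tmapl T H m ∘ c.
  apply: e_epi.
  by rewrite -!mcompA cP meg (hopf_homP g).2 mcompA -tmapl_comp meg.
have a_unit : a ∘ η (aone A) = idm Y.
  apply: m_mono.
  by rewrite mcompA aP -mcompA tmaplE mcompA act_unit comp1m compm1.
have a_assoc : a ∘ tmapl T A a =
    a ∘ tmapr T Y (mulmap : {linear A ⊗ A -> A}) ∘ lassoc T Y A A.
  apply: m_mono.
  rewrite !mcompA aP -(mcompA (act N)) -tmapl_comp aP tmapl_comp mcompA.
  rewrite act_assoc -!mcompA lassoc_natural !mcompA.
  by rewrite -(mcompA (act N) (tmapl T A m)) tmaplr !mcompA.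
pose Qm := ModuleObject a_unit a_assoc.
have c_assoc : rassoc T Y H H ∘ tmapl T H c ∘ c = tmapr T Y (comul H) ∘ c.
  apply: e_epi; rewrite -!mcompA cP !mcompA -(mcompA (rassoc _ _ _ _)).
  rewrite -tmapl_comp cP tmapl_comp mcompA rassoc_natural -tmaplr.
  by rewrite -!mcompA -coact_assoc !mcompA.
have c_counit : runit T Y ∘ tmapr T Y (counit H) ∘ c = idm Y.
  apply: e_epi; rewrite -!mcompA cP !mcompA -(mcompA (runit _ _)) -tmaplr.
  rewrite mcompA runit_natural -!mcompA (mcompA (runit _ _)) coact_counit.
  by rewrite compm1 comp1m.
have c_act : c ∘ a =
    tmapl T H a ∘ tmapr T (Y ⊙ A) (mulmap : {linear H ⊗ H -> H})
      ∘ exchange T Y A H H ∘ tmapr T (Y ⊙ H) (acoact A) ∘ tmapl T A c.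
  apply: (tmapl_epi (T := T) (V := A) e_epi).
  rewrite -[LHS]mcompA aeP mcompA cP -mcompA coact_act.
  rewrite -[RHS]mcompA -tmapl_comp cP tmapl_comp !mcompA; congr (_ ∘ _).
  rewrite -tmapl_comp -aeP tmapl_comp.
  rewrite -(mcompA _ (tmapr T (Y ⊙ H) _)) -tmaplr !mcompA; congr (_ ∘ _).
  rewrite -(mcompA _ (exchange _ _ _ _ _)) exchange_natural !mcompA; congr (_ ∘ _).
  by rewrite -!mcompA tmaplr.
pose Q : hopf_module T A := HopfModule (hopf_mod := Qm) c_assoc c_counit c_act.
have m_hom : is_hopf_hom (M := Q) (N := N) m by [].
have e_hom : is_hopf_hom (M := M) (N := Q) e by [].
exists Q, (mk_hopf_hom m_hom), (mk_hopf_hom e_hom).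
by split=> //; apply: val_inj.
Qed.

End Image.

(** * Membership in F in terms of arbitrary Hopf module maps *)

(** The image of [g] is a Hopf subobject inside the kernel of [integral_map], hence lies below the
    sum of all such subobjects, which is zero. *)
Lemma in_F_killed (phi : {linear H -> k^o}) (M X : hopf_cat T A)
    (g : mor X M) :
  in_F phi M -> integral_map phi M ∘ forget g = 0 -> g = 0.
Proof.
move=> [Z [j [[_ j_ub _] Z0]]] g0.
have [Y [C [m [e [q [meg mP e_epi]]]]]] := image_exists S_abelian (forget g).
have [Q [m' [e' [gE m'_mono e'_epi]]]] := image_hopf (g := g) meg mP e_epi.
have m'0 : integral_map phi M ∘ (m' : mor Q (M : hopf_module T A)) = 0.
  by apply: e'_epi; rewrite comp0l -g0 -gE -mcompA.
have [K [i iP]] := abelian_kernel S_abelian (integral_map phi M).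
have [u uP] : sub_le (m' : mor (Q : hopf_cat T A) M) j.
  apply: j_ub; last by exists K, i; split=> //; exact: kernel_factor iP m'0.
  (* Forgetting to S is faithful, so a mono in S is a mono of Hopf modules. *)
  move=> W a b ab; apply: val_inj; apply: m'_mono.
  exact: (congr1 val ab).
rewrite -gE -[hopf_comp m' e']/(mcomp (m' : mor (Q : hopf_cat T A) M) e').
by rewrite -uP -(comp1m u) Z0 comp0l comp0r comp0l.
Qed.

Lemma in_F_intro (phi : {linear H -> k^o}) (M Z : hopf_cat T A) :
  is_zero Z ->
  (forall (X : hopf_cat T A) (f : mor X M),
     integral_map phi M ∘ forget f = 0 -> f = 0) ->
  in_F phi M.
Proof.
move=> Z0 M0; exists Z, 0; split=> //; split=> [W a b _|X i _|L l _ _].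
- by rewrite -(comp1m a) -(comp1m b) Z0 !comp0l.
- move=> [K [j [[j0 _] [u uP]]]]; exists 0; rewrite comp0l (M0 _ i) //.
  by rewrite -uP mcompA j0 comp0l.
- by exists 0; rewrite comp0r.
Qed.

(** * Extending a map to [N] to a Hopf module map to Hom(A, N) ⊗ H *)

Section Cofree.
Variables (ih : internal_hom T) (N : S) (X : hopf_module T A) (f : mor X N).

(* Informally, x ↦ (a ↦ f(a x)). *)
Definition module_adjunct : mor X (ihom ih A N) := icurry ih (f ∘ act X).

Lemma module_adjunctE (a : A) :
  iev ih ∘ η a ∘ module_adjunct = f ∘ act X ∘ η a.
Proof. by rewrite /module_adjunct -tmaplEr icurryE. Qed.

(** At [x] in A, both sides send a ⊗ y to f((xa)y) = f(x(ay)). *)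
Lemma module_adjunct_act :
  module_adjunct ∘ act X = ihom_act A ih N ∘ tmapl T A module_adjunct.
Proof.
move: module_adjunct module_adjunctE => g gE.
apply: ihom_ext_elt => x; apply: tob_ext => a.
rewrite !mcompA tmaplEr gE ihom_actE gE.
by rewrite -!(mcompA f) -act_assocE !mcompA.
Qed.

Definition cofree_adjunct : mor X (ihom ih A N ⊙ H) :=
  tmapl T H module_adjunct ∘ coact X.

(** A-linearity combines [coact_act] with the linearity of [module_adjunct]; compatibility with the
    coactions is coassociativity of [coact], rebracketed by [rassoc_inv]. *)
Lemma cofree_adjunct_hom :
  is_hopf_hom (M := X) (N := free_hopf (ihom_module A ih N)) cofree_adjunct.
Proof.
rewrite /cofree_adjunct; split=> /=.
  rewrite -mcompA coact_act tmapl_comp !mcompA; congr (_ ∘ _).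
  rewrite -tmapl_comp module_adjunct_act tmapl_comp /free_act /free_pre.
  rewrite -(mcompA _ (tmapr T (_ ⊙ H) _)) -tmaplr !mcompA; congr (_ ∘ _).
  rewrite -(mcompA _ (exchange _ _ _ _ _)) exchange_natural !mcompA; congr (_ ∘ _).
  by rewrite -!mcompA tmaplr.
rewrite /cofree_coact mcompA -(mcompA _ (tmapr _ _ _)) -tmaplr mcompA.
rewrite -[LHS]mcompA -coact_assoc !mcompA -(mcompA (rassoc_inv _ _ _ _)).
by rewrite -rassoc_natural mcompA rassocK comp1m -tmapl_comp.
Qed.

Lemma cofree_adjunctK :
  iev ih ∘ η (aone A) ∘ runit T (ihom ih A N)
    ∘ tmapr T (ihom ih A N) (counit H) ∘ cofree_adjunct = f.
Proof.
rewrite /cofree_adjunct mcompA -(mcompA _ (tmapr _ _ _)) -tmaplr mcompA.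
rewrite -(mcompA _ (runit _ _)) runit_natural mcompA module_adjunctE.
rewrite -[X in X ∘ runit _ _]mcompA act_unit compm1.
by rewrite -!mcompA (mcompA (runit _ _)) coact_counit compm1.
Qed.

End Cofree.

End Hopf.

Theorem theorem7p10 (k : fieldType) (S : lincat k) (HS : grothendieck S)
    (T : tensoring S) (ih : internal_hom T)
    (I : S) (I_injective : injective_obj I) (I_cogenerator : cogenerator_obj I)
    (H : hopf_algebra k) (phi : {linear H -> k^o})
    (phi_integral : normalized_integral phi)
    (A : comodule_algebra H)
    (HF : in_F phi (free_hopf (ihom_module A ih I)))
    (M : hopf_cat T A) :
  in_F phi M.
Proof.
have S_abelian := groth_abelian HS.
(* The hypothesis [HF] also supplies a zero object of the Hopf module category. *)
have [Z [_ [_ Z0]]] := HF.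
apply: (in_F_intro Z0) => X i i0.
(* Since [i] need not be mono, [integral_map] may be nonzero on [X]; it does vanish on the image
   [Q]. *)
have [Y [C [m [e [q [mei mP e_epi]]]]]] := image_exists S_abelian (forget i).
have [Q [m' [e' [iE m'_mono e'_epi]]]] :=
  image_hopf S_abelian I_injective I_cogenerator (g := i) mei mP e_epi.
have Q_phi0 : integral_map phi (Q : hopf_cat T A) = 0.
  apply: m'_mono; apply: e'_epi; rewrite comp0r comp0l.
  have := integral_map_natural phi (m' : mor (Q : hopf_cat T A) M).
  by rewrite /forget => <-; rewrite -mcompA -i0 -iE.
have Q0 : idm (Q : S) = 0.
  apply: (cogenerator_separates S_abelian I_cogenerator) => f; rewrite compm1.
  pose g : mor (Q : hopf_cat T A) (free_hopf (ihom_module A ih I)) :=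
    mk_hopf_hom (cofree_adjunct_hom ih f).
  have g0 : g = 0.
    apply: (in_F_killed S_abelian I_injective I_cogenerator HF).
    by rewrite integral_map_natural Q_phi0 comp0r.
  have ga0 : cofree_adjunct ih f = 0 by exact: (congr1 val g0).
  by rewrite -(cofree_adjunctK ih f) ga0 comp0r.
rewrite -iE; apply: val_inj.
by rewrite /= -[hopf_hom_val m']compm1 Q0 comp0r comp0l.
Qed.
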